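(* There is an absolute constant $c>0$ such that for every connected planar graph $G$ with $N$ vertices and every routing that sends one unit of flow between each unordered pair of distinct vertices of $G$ along paths in $G$ (not necessarily shortest paths), the maximum vertex flow $M_v$ satisfies $$c\,N^{3/2}\le M_v\le \frac{N(N-1)}{2}.$$ In particular $M_v$ lies between order $N^{3/2}$ and order $N^2$.
   Context: For a routing on a finite connected graph $G$ in which one unit of flow is sent between each unordered pair of distinct vertices (possibly split among several paths), the vertex flow $T(u)$ of a vertex $u$ is the total amount of flow, over all pairs (including pairs having $u$ as an endpoint), passing through $u$; the maximum vertex flow is $M_v=\max_u T(u)$.
   Formalization: The formal theorem assumes N ≥ 2, because for the one-vertex graph there are no pairs, so M_v = 0 and the lower bound c N^{3/2} ≤ M_v fails for every c > 0. *)

(* Defs.v *)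
From Stdlib Require Import Reals.
From mathcomp Require Import all_boot.
Open Scope R_scope.

Set Implicit Arguments.
Unset Strict Implicit.
Unset Printing Implicit Defensive.

Definition simple_graph (N : nat) (adj : rel 'I_N) : Prop :=
  symmetric adj /\ irreflexive adj.

Definition connected_graph (N : nat) (adj : rel 'I_N) : Prop :=
  forall x y : 'I_N, connect adj x y.

(* ---------- planarity (Diestel: polygonal arcs in R^2) ---------- *)

Definition pt := (R * R)%type.
Definition p0 : pt := (0, 0).

Definition on_seg (a b x : pt) : Prop :=
  exists l : R, (0 <= l <= 1) /\
    fst x = ((1 - l) * fst a + l * fst b) /\
    snd x = ((1 - l) * snd a + l * snd b).

Definition on_arc (L : seq pt) (x : pt) : Prop :=
  exists i : nat, (i.+1 < size L)%N /\ on_seg (nth p0 L i) (nth p0 L i.+1) x.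

(* L describes a polygonal arc (homeomorphic to [0,1]): at least one
   segment, nondegenerate segments, consecutive segments meet only in their
   common point, non-consecutive segments are disjoint. *)
Definition simple_arc (L : seq pt) : Prop :=
  (2 <= size L)%N /\
  (forall i : nat, (i.+1 < size L)%N -> nth p0 L i <> nth p0 L i.+1) /\
  (forall (i j : nat) (x : pt), (i < j)%N -> (j.+1 < size L)%N ->
     on_seg (nth p0 L i) (nth p0 L i.+1) x ->
     on_seg (nth p0 L j) (nth p0 L j.+1) x ->
     j = i.+1 /\ x = nth p0 L j).

Definition arc_interior (L : seq pt) (x : pt) : Prop :=
  on_arc L x /\ x <> head p0 L /\ x <> last p0 L.

Definition plane_embedding (N : nat) (adj : rel 'I_N)
    (pos : 'I_N -> pt) (arc : 'I_N -> 'I_N -> seq pt) : Prop :=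
  injective pos /\
  (forall x y : 'I_N, adj x y -> (x < y)%N ->
     simple_arc (arc x y) /\ head p0 (arc x y) = pos x /\
     last p0 (arc x y) = pos y) /\
  (forall x y z : 'I_N, adj x y -> (x < y)%N ->
     ~ arc_interior (arc x y) (pos z)) /\
  (forall x y x' y' : 'I_N, adj x y -> (x < y)%N -> adj x' y' -> (x' < y')%N ->
     (x, y) <> (x', y') ->
     forall p : pt, arc_interior (arc x y) p -> ~ on_arc (arc x' y') p).

Definition planar (N : nat) (adj : rel 'I_N) : Prop :=
  exists pos arc, plane_embedding adj pos arc.

Definition simple_path (N : nat) (adj : rel 'I_N) (s t : 'I_N) (p : seq 'I_N)
  : bool :=
  [&& path adj s p, last s p == t & uniq (s :: p)].

Definition Rsum (l : seq R) : R := foldr Rplus 0 l.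

(* A routing assigns to each unordered pair {s,t} (encoded s < t) a finite
   list of (path, amount) pairs: nonnegative amounts along s-t paths of G,
   summing to one unit. *)
Definition routing (N : nat) (adj : rel 'I_N)
    (rt : 'I_N -> 'I_N -> seq (seq 'I_N * R)) : Prop :=
  forall s t : 'I_N, (s < t)%N ->
    (forall e, List.In e (rt s t) -> simple_path adj s t e.1 /\ (0 <= e.2)) /\
    Rsum (map snd (rt s t)) = 1.

Definition upairs (N : nat) : seq ('I_N * 'I_N) :=
  [seq st : 'I_N * 'I_N <- [seq (s, t) | s <- enum 'I_N, t <- enum 'I_N]
    | (st.1 < st.2)%N].

(* T(u): total flow, over all pairs, along paths visiting u (endpoints
   included) *)
Definition vertex_flow (N : nat) (rt : 'I_N -> 'I_N -> seq (seq 'I_N * R))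
    (u : 'I_N) : R :=
  Rsum [seq Rsum [seq e.2 | e <- rt st.1 st.2 & u \in st.1 :: e.1]
       | st <- upairs N].

Definition max_vertex_flow (N : nat) (rt : 'I_N -> 'I_N -> seq (seq 'I_N * R))
  : R :=
  foldr Rmax 0 [seq vertex_flow rt u | u <- enum 'I_N].

(* Main.v *)
Require Import Defs.
From HB Require Import structures.
From Stdlib Require Import Reals Lra Bool Ring Classical.
From mathcomp Require Import all_boot.
From Coquelicot Require Import Compactness.
Open Scope R_scope.

Set Implicit Arguments.
Unset Strict Implicit.
Unset Printing Implicit Defensive.

(** The lower bound is a crossing-number argument. Given five vertices and ten paths
    joining them in a plane graph, two paths with disjoint ends must share a vertex: otherwise
    the paths would trace a drawing of [K_5] in which independent edges are disjoint, whereas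
    the number of crossings between independent edges of [K_5] is odd for every generic
    polygonal drawing. Choosing a path for each pair at random, with the amounts of flow as
    probabilities, and writing [f_e u] for the flow of the pair [e] through [u], every five
    vertices therefore satisfy [1 <= \sum_(e, f independent) \sum_u f_e u * f_f u]. Summing
    over all five-element sets gives ['C(N, 5) <= C N \sum_u T(u) ^ 2 <= C N ^ 2 M ^ 2], that
    is [M >= c N ^ (3/2)]. *)

(** * Crossings of segments *)

(** Planarity enters only through the disjointness of the arcs of vertex-disjoint edges. The
    topology is reduced to signs of determinants: crossing a segment and lying in a triangle are
    boolean functions of [orient], so neither the Jordan curve theorem nor Euler's formula appears.
    The parity is odd because the ten polygonal edges can be replaced by segments one at a time
    without changing it, and ten straight segments are settled by cases. The obstacle is genericity.
    Curves that trace paths may repeat points, and curves of edges with a common end may overlap at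
    will. Hence only independent pairs are counted, the chains carry formal labels that stay
    distinct where the points coincide, and each label moves its point in a direction of its own.
    Disjoint segments are compact, so they lie at positive distance, and a small enough move keeps
    them disjoint. The upper bound is separate: no pair contributes more than its one unit to a
    vertex. *)

Definition is_pos (r : R) : bool := if Rlt_dec 0 r then true else false.

Lemma is_posP (r : R) : r <> 0 -> (is_pos r = true /\ 0 < r) \/ (is_pos r = false /\ r < 0).
Proof. rewrite /is_pos => r0; case: Rlt_dec => h; [by left|right]; split=> //; lra. Qed.

Lemma is_posM (x y : R) : x <> 0 -> y <> 0 -> is_pos (x * y) = negb (xorb (is_pos x) (is_pos y)).
Proof.
move=> x0 y0; have xy0 : x * y <> 0 by apply: Rmult_integral_contrapositive.
by case: (is_posP x0) => -[-> hx]; case: (is_posP y0) => -[-> hy];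
  case: (is_posP xy0) => -[-> h] //=; nra.
Qed.

Lemma is_pos_sum3 (x y z : R) : x <> 0 -> y <> 0 -> z <> 0 -> x + y + z = 0 ->
  ~ (is_pos x = is_pos y /\ is_pos y = is_pos z).
Proof.
move=> x0 y0 z0 s0; case: (is_posP x0) => -[-> hx]; case: (is_posP y0) => -[-> hy];
  case: (is_posP z0) => -[-> hz] //=; try lra; by case.
Qed.

Definition det3 (a b c : pt) : R :=
  (b.1 - a.1) * (c.2 - a.2) - (b.2 - a.2) * (c.1 - a.1).

Lemma det3_rot (a b c : pt) : det3 b c a = det3 a b c.
Proof. rewrite /det3; ring. Qed.

Lemma det3_swap (a b c : pt) : det3 b a c = - det3 a b c.
Proof. rewrite /det3; ring. Qed.

Definition orient (a b c : pt) : bool := is_pos (det3 a b c).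

(** Meant for points no three of which are collinear: [is_pos] sends 0 to [false], so a degenerate
    configuration gets a value without geometric meaning. *)
Definition crosses (a b c d : pt) : bool :=
  xorb (orient a b c) (orient a b d) && xorb (orient c d a) (orient c d b).

Definition in_triangle (a b c p : pt) : bool :=
  eqb (orient a b p) (orient b c p) && eqb (orient b c p) (orient c a p).

Lemma orient_rot (a b c : pt) : orient b c a = orient a b c.
Proof. by rewrite /orient det3_rot. Qed.

Lemma orient_swap (a b c : pt) : det3 a b c <> 0 -> orient b a c = negb (orient a b c).
Proof.
move=> n0; have n1 : det3 b a c <> 0 by rewrite det3_swap; lra.
rewrite /orient; case: (is_posP n0) => -[-> ?]; case: (is_posP n1) => -[-> ?] //=.
  by move: (det3_swap a b c); lra.
by move: (det3_swap a b c); lra.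
Qed.

Lemma crosses_sym (a b c d : pt) : crosses c d a b = crosses a b c d.
Proof. by rewrite /crosses andbC. Qed.

Lemma crosses_flip (a b c d : pt) : det3 a b c <> 0 -> det3 a b d <> 0 ->
  crosses b a c d = crosses a b c d.
Proof.
move=> h1 h2; rewrite /crosses !(orient_swap (a := a)) //.
by case: (orient a b c); case: (orient a b d);
  case: (orient c d a); case: (orient c d b).
Qed.

(** A segment changes side each time it crosses the boundary of the triangle. The proof uses two
    sign constraints only, one for [p] and one for [q]; every choice of the nine signs that
    satisfies both satisfies the equation. *)
Lemma crosses_triangle (a b c p q : pt) :
  det3 a b p <> 0 -> det3 b c p <> 0 -> det3 c a p <> 0 ->
  det3 a b q <> 0 -> det3 b c q <> 0 -> det3 c a q <> 0 ->
  det3 p q a <> 0 -> det3 p q b <> 0 -> det3 p q c <> 0 ->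
  xorb (xorb (crosses a b p q) (crosses b c p q)) (crosses c a p q) =
  xorb (in_triangle a b c p) (in_triangle a b c q).
Proof.
move=> abp bcp cap abq bcq caq pqa pqb pqc.
(* In homogeneous coordinates, [det3 a b r * c + det3 b c r * a + det3 c a r * b = det3 a b c * r].
   Applying [det3 p q] to both sides leaves [det3 a b c * det3 p q r] on the right, which vanishes
   for [r = p] and [r = q]. *)
have gp r : r = p \/ r = q -> det3 a b r * det3 p q c + det3 b c r * det3 p q a
    + det3 c a r * det3 p q b = 0.
  by rewrite /det3 => -[] ->; ring.
have nz x y : x <> 0 -> y <> 0 -> x * y <> 0.
  by move=> ? ?; apply: Rmult_integral_contrapositive.
have := is_pos_sum3 (nz _ _ abp pqc) (nz _ _ bcp pqa) (nz _ _ cap pqb) (gp p (or_introl erefl)).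
have := is_pos_sum3 (nz _ _ abq pqc) (nz _ _ bcq pqa) (nz _ _ caq pqb) (gp q (or_intror erefl)).
rewrite !is_posM // /crosses /in_triangle /orient.
case: (is_pos (det3 a b p)); case: (is_pos (det3 b c p)); case: (is_pos (det3 c a p));
case: (is_pos (det3 a b q)); case: (is_pos (det3 b c q)); case: (is_pos (det3 c a q));
case: (is_pos (det3 p q a)); case: (is_pos (det3 p q b)); case: (is_pos (det3 p q c)) => //=;
 move=> h1 h2; first [by case: h1 | by case: h2].
Qed.

Lemma crosses_meet (a b c d : pt) : det3 a b c <> 0 -> det3 a b d <> 0 ->
  det3 c d a <> 0 -> det3 c d b <> 0 -> crosses a b c d ->
  exists x, on_seg a b x /\ on_seg c d x.
Proof.
move=> h1 h2 h3 h4; rewrite /crosses /orient.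
(* Both differences are, up to sign, the cross product of the two directions, so one nonzero
   denominator serves for [s] and [u]. Each parameter is the zero, along one segment, of the affine
   form that defines the line of the other. *)
have E : det3 c d a - det3 c d b = - (det3 a b c - det3 a b d) by rewrite /det3; ring.
have frac (x y : R) : (0 < x /\ y < 0) \/ (x < 0 /\ 0 < y) -> 0 <= x / (x - y) <= 1.
  move=> h; have n0 : x - y <> 0 by lra.
  have e : x / (x - y) * (x - y) = x by field.
  by case: h => h; split; nra.
set s := det3 c d a / (det3 c d a - det3 c d b).
set u := det3 a b c / (det3 a b c - det3 a b d).
have key : (0 < det3 a b c /\ det3 a b d < 0) \/ (det3 a b c < 0 /\ 0 < det3 a b d) ->
  (0 < det3 c d a /\ det3 c d b < 0) \/ (det3 c d a < 0 /\ 0 < det3 c d b) ->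
  exists x, on_seg a b x /\ on_seg c d x.
  move=> k1 k2; exists ((1 - s) * a.1 + s * b.1, (1 - s) * a.2 + s * b.2); split.
    by exists s; split; first exact: frac.
  exists u; split; first exact: frac.
  rewrite /s E /u; move: k1 k2 => /= k1 k2.
  have n0 : det3 a b c - det3 a b d <> 0 by lra.
  by move: n0; rewrite /det3 => n0; split; field; lra.
case: (is_posP h1) => -[-> k1]; case: (is_posP h2) => -[-> k2];
case: (is_posP h3) => -[-> k3]; case: (is_posP h4) => -[-> k4] //= _; apply: key; lra.
Qed.

(** * Parity of crossings in polygonal drawings of [K_5] *)

(** Booleans under [xorb] stand for the field with two elements, and [chain g x s] is the value of
    the 1-cochain [g] on the path [x :: s]. *)
Fixpoint chain (T : Type) (g : T -> T -> bool) (x : T) (s : seq T) : bool :=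
  if s is y :: s' then xorb (g x y) (chain g y s') else false.

Section Chain.
Variable T : eqType.
Implicit Types (g : T -> T -> bool) (x y : T) (s : seq T).

Lemma eq_chain g g' x s :
  uniq (x :: s) ->
  (forall p q, p \in x :: s -> q \in x :: s -> p != q -> g p q = g' p q) ->
  chain g x s = chain g' x s.
Proof.
elim: s x => //= y s IH x /andP[xs us] h; rewrite IH //.
  rewrite h ?in_cons ?eqxx ?orbT //; move: xs; rewrite in_cons negb_or; by case/andP.
by move=> p q hp hq; apply: h; rewrite in_cons ?hp ?hq orbT.
Qed.

Lemma chain_xor g g' x s :
  chain (fun p q => xorb (g p q) (g' p q)) x s = xorb (chain g x s) (chain g' x s).
Proof. by elim: s x => //= y s IH x; rewrite IH; ring. Qed.

Lemma chain_false x s : chain (fun _ _ => false) x s = false.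
Proof. by elim: s x => //= y s IH x; rewrite IH. Qed.

Lemma chain_telescope (I : T -> bool) x s :
  chain (fun p q => xorb (I p) (I q)) x s = xorb (I x) (I (last x s)).
Proof. elim: s x => //= [|y s IH] x; rewrite ?IH; ring. Qed.

Lemma exchange_chain (h : T -> T -> T -> T -> bool) x s y s' :
  chain (fun p q => chain (h p q) y s') x s =
  chain (fun c d => chain (fun p q => h p q c d) x s) y s'.
Proof. by elim: s x => [|z s IH] x /=; rewrite ?chain_false // IH chain_xor. Qed.

(** Additivity lets intermediate points be dropped one by one. It is assumed for distinct points
    only, because [crosses] is meaningless on degenerate triangles; this is why the entries of the
    path must be distinct. *)
Lemma chain_cocycle g x s :
  (forall p q r, p \in x :: s -> q \in x :: s -> r \in x :: s ->
     p != q -> q != r -> p != r -> g p r = xorb (g p q) (g q r)) ->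
  uniq (x :: s) -> s != [::] -> chain g x s = g x (last x s).
Proof.
elim: s x => //= y s IH x h /andP[xs /= /andP[ys us]] _.
case: s => [|z s] in IH h xs ys us *; first by rewrite /=; ring.
have mem a : a \in y :: z :: s -> a \in [:: x, y, z & s] by move=> ha; rewrite in_cons ha orbT.
rewrite IH //=; last by rewrite ys.
  rewrite [RHS](h x y) //=; rewrite ?mem_head //.
  - by apply: mem; rewrite mem_head.
  - by do 2!rewrite in_cons; rewrite mem_last !orbT.
  - by apply: contraNneq xs => ->; rewrite mem_head.
  - by apply: contraNneq ys => ->; rewrite mem_last.
  - by apply: contraNneq xs => ->; rewrite in_cons mem_last orbT.
by move=> p q r hp hq hr; apply: h; apply: mem.
Qed.

End Chain.

Section VanKampen.
Variables (T : eqType) (P : T -> pt) (D : pred T).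
Hypothesis gp : forall a b c, D a -> D b -> D c -> a != b -> a != c -> b != c ->
  det3 (P a) (P b) (P c) <> 0.

Let X (a b c d : T) : bool := crosses (P a) (P b) (P c) (P d).

Lemma crosses_triangle_chain (a b c k : T) (A : seq T) :
  a != b -> b != c -> a != c -> D a -> D b -> D c -> uniq (k :: A) -> all D (k :: A) ->
  a \notin k :: A -> b \notin k :: A -> c \notin k :: A ->
  xorb (xorb (chain (X a b) k A) (chain (X b c) k A)) (chain (X a c) k A) =
  xorb (in_triangle (P a) (P b) (P c) (P k)) (in_triangle (P a) (P b) (P c) (P (last k A))).
Proof.
move=> ab bc ac Da Db Dc uA /allP DA aA bA cA; rewrite -!chain_xor.
rewrite -(chain_telescope (fun p => in_triangle (P a) (P b) (P c) (P p))).
apply: eq_chain => // p q hp hq pq; rewrite /X.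
have nA z w : z \notin k :: A -> w \in k :: A -> (z != w) && (w != z).
  by move=> zA wA; rewrite (eq_sym w) andbb; apply: contraNneq zA => ->.
have [ap pa] := andP (nA _ _ aA hp); have [bp pb] := andP (nA _ _ bA hp).
have [cp pc] := andP (nA _ _ cA hp); have [aq qa] := andP (nA _ _ aA hq).
have [bq qb] := andP (nA _ _ bA hq); have [cq qc] := andP (nA _ _ cA hq).
have [ca ba cb] : [/\ c != a, b != a & c != b] by rewrite !(eq_sym c) (eq_sym b).
have Dp := DA _ hp; have Dq := DA _ hq.
by rewrite -(@crosses_flip (P a) (P c)) ?crosses_triangle //; apply: gp.
Qed.

(** [G p q] counts crossings with the closed curve formed by the three chains. For a triangle
    [p q r], each chain has an additivity defect located at its two ends; each of [k], [l], [m] ends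
    two chains, so the six defects cancel modulo 2 and [G] is a cocycle. *)
Lemma chain_vs_triangle (i : T) (s : seq T) (k l m : T) (A B C : seq T) :
  uniq (i :: s) -> s != [::] -> all D (i :: s) ->
  uniq (k :: A) -> all D (k :: A) -> uniq (k :: B) -> all D (k :: B) ->
  uniq (l :: C) -> all D (l :: C) ->
  last k A = l -> last k B = m -> last l C = m ->
  ~~ has (mem (i :: s)) (k :: A) -> ~~ has (mem (i :: s)) (k :: B) ->
  ~~ has (mem (i :: s)) (l :: C) ->
  let G p q := xorb (xorb (chain (X p q) k A) (chain (X p q) k B)) (chain (X p q) l C) in
  chain G i s = G i (last i s).
Proof.
move=> us s0 /allP Ds uA DA uB DB uC DC lA lB lC hA hB hC G.
apply: chain_cocycle => // p q r hp hq hr pq qr pr.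
have nA z y (S : seq T) : ~~ has (mem (i :: s)) (y :: S) -> z \in i :: s -> z \notin y :: S.
  by move=> /hasPn h zi; apply/negP => /h /=; rewrite zi.
have tri y S : uniq (y :: S) -> all D (y :: S) -> ~~ has (mem (i :: s)) (y :: S) ->
    chain (X p r) y S = xorb (xorb (xorb (chain (X p q) y S) (chain (X q r) y S))
       (in_triangle (P p) (P q) (P r) (P y))) (in_triangle (P p) (P q) (P r) (P (last y S))).
  move=> uS DS hS.
  have := @crosses_triangle_chain p q r y S pq qr pr (Ds _ hp) (Ds _ hq) (Ds _ hr) uS DS
    (nA _ _ _ hS hp) (nA _ _ _ hS hq) (nA _ _ _ hS hr).
  move: (chain _ _ _) (chain _ _ _) (chain _ _ _) (in_triangle _ _ _ _) (in_triangle _ _ _ _).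
  by do 5!case.
by rewrite /G !tri // lA lB lC; ring.
Qed.

Variable v : nat -> T.
Implicit Type L : nat -> nat -> seq T.

Definition edge_chain L (i j : nat) : seq T := rcons (L i j) (v j).

Definition cross_parity L (i j k l : nat) : bool :=
  chain (fun p q => chain (X p q) (v k) (edge_chain L k l)) (v i) (edge_chain L i j).

Lemma cross_parity_sym L i j k l : cross_parity L k l i j = cross_parity L i j k l.
Proof.
rewrite /cross_parity exchange_chain; elim: (edge_chain L i j) (v i) => //= y s IH x.
rewrite IH; congr xorb; elim: (edge_chain L k l) (v k) => //= z s' IH' y'.
by rewrite IH' /X crosses_sym.
Qed.

(** The fifteen unordered pairs of independent edges of [K_5], each listed once, with the edge
    through the smallest of the four vertices first. *)
Definition total_parity L : bool :=
  xorb (cross_parity L 0 1 2 3) (xorb (cross_parity L 0 1 2 4) (xorb (cross_parity L 0 1 3 4) (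
  xorb (cross_parity L 0 2 1 3) (xorb (cross_parity L 0 2 1 4) (xorb (cross_parity L 0 2 3 4) (
  xorb (cross_parity L 0 3 1 2) (xorb (cross_parity L 0 3 1 4) (xorb (cross_parity L 0 3 2 4) (
  xorb (cross_parity L 0 4 1 2) (xorb (cross_parity L 0 4 1 3) (xorb (cross_parity L 0 4 2 3) (
  xorb (cross_parity L 1 2 3 4) (xorb (cross_parity L 1 3 2 4) (cross_parity L 1 4 2 3)))))))))))))).

(** The conditions bear on labels, not on points. Chains of edges with a common end are left free to
    share labels, since such pairs do not enter [total_parity]. *)
Definition admissible L : Prop :=
  (forall i j, (i < j < 5)%N ->
     uniq (v i :: edge_chain L i j) /\ all D (v i :: edge_chain L i j)) /\
  (forall i j k l, (i < j < 5)%N -> (k < l < 5)%N -> uniq [:: i; j; k; l] ->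
     ~~ has (mem (v i :: edge_chain L i j)) (v k :: edge_chain L k l)).

Definition straighten L (i j : nat) : nat -> nat -> seq T :=
  fun a b => if (a == i) && (b == j) then [::] else L a b.

Lemma admissible_straighten L i j : admissible L -> admissible (straighten L i j).
Proof.
case=> h1 h2.
have sub a b : subseq (v a :: edge_chain (straighten L i j) a b) (v a :: edge_chain L a b).
  rewrite /= eqxx /edge_chain /straighten; case: ifP => // _.
  by rewrite /= sub1seq mem_rcons mem_head.
split=> [a b ab|a b c d ab cd u].
  have [u1 d1] := h1 a b ab; split; first exact: (subseq_uniq (sub a b) u1).
  by apply/allP => z /(mem_subseq (sub a b)) hz; apply: (allP d1).
apply/hasPn => z /(mem_subseq (sub c d)) hz; apply/negP => /(mem_subseq (sub a b)) hz'.
by have /hasPn/(_ z hz) := h2 a b c d ab cd u; rewrite /= hz'.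
Qed.

(* The edges of [K_5] disjoint from [i j] form a triangle. The closed curve made of the chain
   [i j] and the segment [i j] crosses this closed curve an even number of times. *)
Lemma cross_parity_straighten L i j k l m : admissible L -> (i < j < 5)%N ->
  (k < l)%N -> (l < m < 5)%N -> uniq [:: i; j; k; l; m] ->
  let L' := straighten L i j in
  xorb (xorb (cross_parity L i j k l) (cross_parity L i j k m)) (cross_parity L i j l m) =
  xorb (xorb (cross_parity L' i j k l) (cross_parity L' i j k m)) (cross_parity L' i j l m).
Proof.
move=> [h1 h2] ij kl /andP[lm m5] u L'.
have l5 := ltn_trans lm m5; have km := ltn_trans kl lm.
have [u1 d1] := h1 i j ij.
have klP : (k < l < 5)%N by rewrite kl.
have kmP : (k < m < 5)%N by rewrite km.
have lmP : (l < m < 5)%N by rewrite lm.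
have [u2 d2] := h1 k l klP; have [u3 d3] := h1 k m kmP; have [u4 d4] := h1 l m lmP.
move: (u); rewrite /= !inE !negb_or !andbT => /and4P[/and4P[ij' ik il im] /and3P[jk jl jm] _ _].
have du : [/\ uniq [:: i; j; k; l], uniq [:: i; j; k; m] & uniq [:: i; j; l; m]].
  by rewrite /= !inE !negb_or ij' ik il im jk jl jm !neq_ltn kl km lm.
case: du => w1 w2 w3.
have eL a b : ((a == i) && (b == j)) = false -> edge_chain L' a b = edge_chain L a b.
  by rewrite /edge_chain /L' /straighten => ->.
have eij : edge_chain L' i j = [:: v j] by rewrite /edge_chain /L' /straighten !eqxx.
rewrite /cross_parity eij !eL -?chain_xor; try by rewrite ?(eq_sym k) ?(eq_sym l)
  ?(negbTE ik) ?(negbTE il).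
rewrite (@chain_vs_triangle _ _ _ (v l) (v m)) ?last_rcons //=; try exact: h2.
- by ring.
- by rewrite /edge_chain; case: (L i j).
Qed.

Lemma xorb_transfer (s s' x y : bool) : x = y -> xorb s s' = xorb x y -> s = s'.
Proof. by move=> ->; case: s s' y => -[] []. Qed.

(** Only the three terms that pair [i j] with a side of the triangle on the other three vertices can
    change, and [cross_parity_straighten] says that their sum does not. *)
Lemma total_parity_straighten L i j : admissible L -> (i < j < 5)%N ->
  total_parity (straighten L i j) = total_parity L.
Proof.
move=> adm ij.
have step k l m := @cross_parity_straighten L i j k l m adm ij.
have same a b c d : (a, b) != (i, j) -> (c, d) != (i, j) ->
    cross_parity (straighten L i j) a b c d = cross_parity L a b c d.
  rewrite !xpair_eqE => ab cd; rewrite /cross_parity /edge_chain /straighten.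
  by rewrite (negbTE ab) (negbTE cd).
have close k l m : (k < l)%N -> (l < m < 5)%N -> uniq [:: i; j; k; l; m] ->
    let x L' := xorb (xorb (cross_parity L' i j k l) (cross_parity L' i j k m))
                 (cross_parity L' i j l m) in
    xorb (total_parity (straighten L i j)) (total_parity L) =
      xorb (x (straighten L i j)) (x L) ->
    total_parity (straighten L i j) = total_parity L.
  by move=> kl lm u x; apply: xorb_transfer; rewrite /x step.
case: i j ij {step} same close =>
  [|[|[|[|[|i]]]]] [|[|[|[|[|j]]]]] // _ same close.
(* In each of the ten cases the numerals are the three vertices other than [i] and [j]. *)
1: apply: (close 2 3 4)%N => //.
2: apply: (close 1 3 4)%N => //.
3: apply: (close 1 2 4)%N => //.
4: apply: (close 1 2 3)%N => //.
5: apply: (close 0 3 4)%N => //.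
6: apply: (close 0 2 4)%N => //.
7: apply: (close 0 2 3)%N => //.
8: apply: (close 0 1 4)%N => //.
9: apply: (close 0 1 3)%N => //.
10: apply: (close 0 1 2)%N => //.
all: rewrite /total_parity
  ?(cross_parity_sym _ 0 1 2 3) ?(cross_parity_sym _ 0 1 2 4) ?(cross_parity_sym _ 0 1 3 4)
  ?(cross_parity_sym _ 0 2 1 3) ?(cross_parity_sym _ 0 2 1 4) ?(cross_parity_sym _ 0 2 3 4)
  ?(cross_parity_sym _ 0 3 1 2) ?(cross_parity_sym _ 0 3 1 4) ?(cross_parity_sym _ 0 3 2 4)
  ?(cross_parity_sym _ 0 4 1 2) ?(cross_parity_sym _ 0 4 1 3) ?(cross_parity_sym _ 0 4 2 3)
  ?(cross_parity_sym _ 1 2 3 4) ?(cross_parity_sym _ 1 3 2 4) ?(cross_parity_sym _ 1 4 2 3).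
all: try rewrite (same 0 1 2 3 isT isT)%N.
all: try rewrite (same 0 1 2 4 isT isT)%N.
all: try rewrite (same 0 1 3 4 isT isT)%N.
all: try rewrite (same 0 2 1 3 isT isT)%N.
all: try rewrite (same 0 2 1 4 isT isT)%N.
all: try rewrite (same 0 2 3 4 isT isT)%N.
all: try rewrite (same 0 3 1 2 isT isT)%N.
all: try rewrite (same 0 3 1 4 isT isT)%N.
all: try rewrite (same 0 3 2 4 isT isT)%N.
all: try rewrite (same 0 4 1 2 isT isT)%N.
all: try rewrite (same 0 4 1 3 isT isT)%N.
all: try rewrite (same 0 4 2 3 isT isT)%N.
all: try rewrite (same 1 2 3 4 isT isT)%N.
all: try rewrite (same 1 3 2 4 isT isT)%N.
all: try rewrite (same 1 4 2 3 isT isT)%N.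
all: ring.
Qed.

(** The orientations of the ten triples determine all fifteen crossings, and the identity holds for
    all 1024 sign patterns, realisable by points or not. Nonzero determinants allow each orientation
    to be rewritten with its triple in sorted order. *)
Lemma straight_parity (a b c d e : pt) :
  det3 a b c <> 0 -> det3 a b d <> 0 -> det3 a b e <> 0 -> det3 a c d <> 0 ->
  det3 a c e <> 0 -> det3 a d e <> 0 -> det3 b c d <> 0 -> det3 b c e <> 0 ->
  det3 b d e <> 0 -> det3 c d e <> 0 ->
  xorb (crosses a b c d) (xorb (crosses a b c e) (xorb (crosses a b d e)
  (xorb (crosses a c b d) (xorb (crosses a c b e) (xorb (crosses a c d e)
  (xorb (crosses a d b c) (xorb (crosses a d b e) (xorb (crosses a d c e)
  (xorb (crosses a e b c) (xorb (crosses a e b d) (xorb (crosses a e c d)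
  (xorb (crosses b c d e) (xorb (crosses b d c e) (crosses b e c d)))))))))))))) = true.
Proof.
move=> abc abd abe acd ace ade bcd bce bde cde.
have canon x y z : det3 x y z <> 0 ->
  [/\ orient y z x = orient x y z, orient z x y = orient x y z,
      orient y x z = negb (orient x y z), orient x z y = negb (orient x y z) &
      orient z y x = negb (orient x y z)].
  move=> h; have h' : det3 y z x <> 0 by rewrite det3_rot.
  have h'' : det3 z x y <> 0 by rewrite -det3_rot.
  have e1 : orient y z x = orient x y z := orient_rot x y z.
  have e2 : orient z x y = orient x y z by rewrite orient_rot.
  by split; rewrite // ?(orient_swap h) ?(orient_swap h') ?(orient_swap h'') ?e1 ?e2.
rewrite /crosses.
have {}canon x y z (h : det3 x y z <> 0) :=
  let: And5 e1 e2 e3 e4 e5 := canon x y z h in (e1, e2, e3, e4, e5).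
rewrite ?(canon _ _ _ abc) ?(canon _ _ _ abd) ?(canon _ _ _ abe) ?(canon _ _ _ acd)
  ?(canon _ _ _ ace) ?(canon _ _ _ ade) ?(canon _ _ _ bcd) ?(canon _ _ _ bce)
  ?(canon _ _ _ bde) ?(canon _ _ _ cde).
by case: (orient a b c); case: (orient a b d); case: (orient a b e);
  case: (orient a c d); case: (orient a c e); case: (orient a d e);
  case: (orient b c d); case: (orient b c e); case: (orient b d e); case: (orient c d e).
Qed.

Lemma total_parity_odd L : admissible L -> total_parity L.
Proof.
move=> adm.
set L' := straighten (straighten (straighten (straighten (straighten (straighten
  (straighten (straighten (straighten (straighten L 0 1) 0 2) 0 3) 0 4) 1 2) 1 3) 1 4)
  2 3) 2 4) 3 4.
have -> : total_parity L = total_parity L'.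
  by rewrite /L' !total_parity_straighten //; do ?apply: admissible_straighten.
have [h1 h2] := adm.
have D_v i : (i < 5)%N -> D (v i).
  case: i => [_|i i5]; first by have [_ /andP[]] := h1 0%N 1%N isT.
  have [_ /allP] := h1 0%N i.+1 i5; apply.
  by rewrite in_cons mem_rcons mem_head orbT.
have neq_v i j : (i < j < 5)%N -> v i != v j.
  move=> ij; have [/andP[+ _] _] := h1 i j ij.
  by apply: contraNneq => ->; rewrite mem_rcons mem_head.
have gp_v i j k : (i < j)%N -> (j < k < 5)%N -> det3 (P (v i)) (P (v j)) (P (v k)) <> 0.
  move=> ij /andP[jk k5]; have j5 := ltn_trans jk k5; have i5 := ltn_trans ij j5.
  by apply: gp; rewrite ?D_v ?neq_v ?ij ?jk ?(ltn_trans ij jk).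
rewrite /is_true -[RHS](@straight_parity (P (v 0)) (P (v 1)) (P (v 2)) (P (v 3)) (P (v 4)));
  try exact: gp_v.
by rewrite /total_parity /cross_parity /= /X !xorb_false_r.
Qed.

End VanKampen.

(** * Perturbation to general position *)

Definition for_small (Q : R -> Prop) : Prop :=
  exists e, 0 < e /\ forall t, 0 < t < e -> Q t.

Lemma for_small_and (Q Q' : R -> Prop) :
  for_small Q -> for_small Q' -> for_small (fun t => Q t /\ Q' t).
Proof.
move=> [e [e0 he]] [e' [e0' he']]; exists (Rmin e e'); split; first exact: Rmin_pos.
by move=> t ht; have := Rmin_l e e'; have := Rmin_r e e'; split; [apply: he|apply: he']; lra.
Qed.

Lemma for_small_all (T : eqType) (s : seq T) (Q : T -> R -> Prop) :
  (forall x, x \in s -> for_small (Q x)) ->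
  for_small (fun t => forall x, x \in s -> Q x t).
Proof.
elim: s => [|y s IH] h; first by exists 1; split; [lra|].
have [|e [e0 he]] := for_small_and (h y (mem_head _ _)) (IH _).
  by move=> x xs; apply: h; rewrite in_cons xs orbT.
exists e; split=> // t ht x; have [hy hs] := he t ht.
by rewrite in_cons => /orP[/eqP ->|] //; apply: hs.
Qed.

Lemma for_small_imp (H : Prop) (Q : R -> Prop) :
  (H -> for_small Q) -> for_small (fun t => H -> Q t).
Proof.
case: (classic H) => h hQ; last by exists 1; split; [lra|].
by have [e [e0 he]] := hQ h; exists e; split=> // t /he.
Qed.

(** Near 0 the nonzero coefficient of lowest degree dominates. When [A = 0] and [B <> 0], a factor
    [t] splits off and leaves [B + C * t]. *)
Lemma for_small_quadratic (A B C : R) :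
  C <> 0 -> for_small (fun t => A + B * t + C * (t * t) <> 0).
Proof.
have lin a b c : a <> 0 -> for_small (fun t => a + b * t + c * (t * t) <> 0).
  move=> a0; have ha := Rabs_pos_lt _ a0; have hb := Rabs_pos b; have hc := Rabs_pos c.
  have k0 : 0 < Rabs b + Rabs c + 1 by lra.
  exists (Rmin 1 (Rabs a / (Rabs b + Rabs c + 1))); split.
    by apply: Rmin_pos; [lra|apply: Rdiv_lt_0_compat].
  move=> t [t0 te] z.
  have t1 : t < 1 by apply: Rlt_le_trans te (Rmin_l _ _).
  have t2 : t < Rabs a / (Rabs b + Rabs c + 1) by apply: Rlt_le_trans te (Rmin_r _ _).
  have t3 : t * (Rabs b + Rabs c + 1) < Rabs a.
    by apply/(Rmult_lt_reg_r (/ (Rabs b + Rabs c + 1)));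
      [exact: Rinv_0_lt_compat | field_simplify; lra].
  have : Rabs a = Rabs (b * t + c * (t * t)) by rewrite -Rabs_Ropp; congr Rabs; lra.
  have := Rabs_triang (b * t) (c * (t * t)).
  rewrite !Rabs_mult (Rabs_pos_eq t); last by lra.
  have : Rabs c * (t * t) <= Rabs c * t by apply: Rmult_le_compat_l => //; nra.
  by nra.
move=> C0; case: (Req_dec A 0) => [->|]; last exact: lin.
case: (Req_dec B 0) => [->|B0].
  exists 1; split=> [|t ht]; first lra; have tt : 0 < t * t by nra.
  rewrite Rmult_0_l !Rplus_0_l; apply: Rmult_integral_contrapositive_currified => //; lra.
have [e [e0 he]] := lin B C 0 B0; exists e; split=> // t ht z; apply: (he t ht).
by apply: (Rmult_eq_reg_l t); lra.
Qed.

(** The l1 distance [n s u] between the two points is positive and continuous on the compact square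
    of parameters, so it has a positive lower bound; [K] serves as its Lipschitz constant. *)
Lemma segments_gap (a b c d : pt) :
  (forall x, on_seg a b x -> ~ on_seg c d x) ->
  exists m, 0 < m /\ forall s u, 0 <= s <= 1 -> 0 <= u <= 1 ->
    m <= Rabs ((1 - s) * a.1 + s * b.1 - ((1 - u) * c.1 + u * d.1)) +
         Rabs ((1 - s) * a.2 + s * b.2 - ((1 - u) * c.2 + u * d.2)).
Proof.
move=> dis.
set f := fun (z : pt -> R) s u => (1 - s) * z a + s * z b - ((1 - u) * z c + u * z d).
set n := fun s u => Rabs (f fst s u) + Rabs (f snd s u).
set K := (Rabs a.1 + Rabs b.1 + Rabs c.1 + Rabs d.1) +
         (Rabs a.2 + Rabs b.2 + Rabs c.2 + Rabs d.2) + 1.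
have K0 : 0 < K by rewrite /K; move: (Rabs_pos a.1) (Rabs_pos b.1) (Rabs_pos c.1)
  (Rabs_pos d.1) (Rabs_pos a.2) (Rabs_pos b.2) (Rabs_pos c.2) (Rabs_pos d.2); lra.
have n0 s u : 0 <= s <= 1 -> 0 <= u <= 1 -> 0 < n s u.
  move=> hs hu; apply: Rnot_le_lt => h.
  have h1 := Rabs_pos (f fst s u); have h2 := Rabs_pos (f snd s u).
  have z1 : f fst s u = 0 by apply: NNPP => /Rabs_pos_lt; rewrite /n in h; lra.
  have z2 : f snd s u = 0 by apply: NNPP => /Rabs_pos_lt; rewrite /n in h; lra.
  apply: (dis ((1 - s) * a.1 + s * b.1, (1 - s) * a.2 + s * b.2)); first by exists s.
  by exists u; split=> //=; rewrite /f in z1 z2; lra.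
have lip (z : pt -> R) x y u v e : Rabs (x - u) <= e -> Rabs (y - v) <= e ->
    Rabs (f z u v) <= Rabs (f z x y) +
      e * (Rabs (z a) + Rabs (z b) + Rabs (z c) + Rabs (z d)).
  move=> hx hy.
  have -> : f z u v = f z x y + ((x - u) * (z a) + (u - x) * z b + (v - y) * z c + (y - v) * z d).
    by rewrite /f; ring.
  have mul w r : Rabs w <= e -> Rabs (w * r) <= e * Rabs r.
    by move=> hw; rewrite Rabs_mult; apply: Rmult_le_compat_r => //; exact: Rabs_pos.
  have hx' : Rabs (u - x) <= e by rewrite Rabs_minus_sym.
  have hy' : Rabs (v - y) <= e by rewrite Rabs_minus_sym.
  set w1 := _ * z a; set w2 := _ * z b; set w3 := _ * z c; set w4 := _ * z d.
  have : Rabs w1 <= e * Rabs (z a) := mul _ _ hx.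
  have : Rabs w2 <= e * Rabs (z b) := mul _ _ hx'.
  have : Rabs w3 <= e * Rabs (z c) := mul _ _ hy'.
  have : Rabs w4 <= e * Rabs (z d) := mul _ _ hy.
  move: (Rabs_triang (f z x y) (w1 + w2 + w3 + w4)) (Rabs_triang (w1 + w2 + w3) w4).
  by move: (Rabs_triang (w1 + w2) w3) (Rabs_triang w1 w2); lra.
(* Within the radius [n s u / (2 * K)] the distance drops by at most half. The value 1 is a filler
   for parameters outside the square, where [n] may vanish. *)
pose delta s u : posreal := match Rlt_dec 0 (n s u / (2 * K)) with
  | left h => mkposreal _ h | right _ => mkposreal 1 Rlt_0_1 end.
have deltaE s u : 0 <= s <= 1 -> 0 <= u <= 1 -> delta s u = n s u / (2 * K) :> R.
  move=> hs hu; rewrite /delta; case: Rlt_dec => //= -[].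
  by apply: Rdiv_lt_0_compat; [exact: n0|lra].
have [e he] := compactness_value_2d 0 1 0 1 delta.
exists (e * K); split; first by apply: Rmult_lt_0_compat => //; exact: cond_pos.
move=> s u hs hu; apply: Rnot_lt_le => lt; apply: (he s u hs hu) => -[x [y [hx [hy]]]].
rewrite deltaE //; set r := n x y / (2 * K) => -[/Rlt_le h1 [/Rlt_le h2 h3]].
have e1 := lip fst _ _ _ _ _ h1 h2; have e2 := lip snd _ _ _ _ _ h1 h2.
have rK : r * K = n x y / 2 by rewrite /r; field; lra.
have r0 : 0 < r by apply: Rlt_le_trans (cond_pos e) h3.
have e3 : n x y <= n s u + r * K by rewrite /n /K; nra.
have : n s u < e * K by [].
have : e * K <= r * K by apply: Rmult_le_compat_r; lra.
lra.
Qed.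

(** The displacement is [t] times a point of the parabola [(k, k ^ 2)], on which no three points are
    collinear. Distinct labels thus pull apart even coincident points. *)
Definition moment_shift (t : R) (k : nat) (p : pt) : pt :=
  (p.1 + t * INR k, p.2 + t * (INR k * INR k)).

(* The coefficient of [t ^ 2] is the Vandermonde determinant of the labels. *)
Lemma generic_moment_shift (p q r : pt) (a b c : nat) : a != b -> a != c -> b != c ->
  for_small (fun t => det3 (moment_shift t a p) (moment_shift t b q) (moment_shift t c r) <> 0).
Proof.
move=> ab ac bc.
have nz x y : x != y -> INR x - INR y <> 0.
  by move=> /eqP xy h; apply: xy; apply: INR_eq; lra.
set A := det3 p q r.
set B := (INR b - INR a) * (r.2 - p.2) + (q.1 - p.1) * (INR c * INR c - INR a * INR a)
  - (INR b * INR b - INR a * INR a) * (r.1 - p.1) - (q.2 - p.2) * (INR c - INR a).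
have [|e [e0 he]] := @for_small_quadratic A B
   ((INR a - INR b) * (INR a - INR c) * (INR b - INR c) * -1).
  by do ?apply: Rmult_integral_contrapositive_currified; try exact: nz; lra.
exists e; split=> // t /he h z; apply: h; rewrite -z /A /B /det3 /=; ring.
Qed.

(** The difference of two points, one on each segment, changes by at most [t * K] in the l1 norm,
    which stays below the gap [m] between the segments. *)
Lemma disjoint_moment_shift (p q r s : pt) (a b c d : nat) :
  (forall x, on_seg p q x -> ~ on_seg r s x) ->
  for_small (fun t => forall x,
    on_seg (moment_shift t a p) (moment_shift t b q) x ->
    ~ on_seg (moment_shift t c r) (moment_shift t d s) x).
Proof.
move=> /segments_gap [m [m0 hm]].
set K := (INR a + INR b + INR c + INR d) +
  (INR a * INR a + INR b * INR b + INR c * INR c + INR d * INR d) + 1.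
have K0 : 0 < K by rewrite /K; move: (pos_INR a) (pos_INR b) (pos_INR c) (pos_INR d); nra.
exists (m / K); split; first exact: Rdiv_lt_0_compat.
move=> t [t0 tm] x [l [hl [x1 x2]]] [u [hu [y1 y2]]].
have tK : t * K < m.
  by apply/(Rmult_lt_reg_r (/ K)); [exact: Rinv_0_lt_compat | field_simplify; lra].
have bnd (x' y z w : R) : 0 <= x' -> 0 <= y -> 0 <= z -> 0 <= w ->
   Rabs ((1 - u) * (t * z) + u * (t * w) - ((1 - l) * (t * x') + l * (t * y)))
   <= t * (x' + y + z + w).
  move=> hx hy hz hw.
  have b1 : 0 <= (1 - u) * z + u * w <= z + w by nra.
  have b2 : 0 <= (1 - l) * x' + l * y <= x' + y by nra.
  by apply: Rabs_le; nra.
have := hm l u hl hu.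
have -> : (1 - l) * p.1 + l * q.1 - ((1 - u) * r.1 + u * s.1) =
  (1 - u) * (t * INR c) + u * (t * INR d) - ((1 - l) * (t * INR a) + l * (t * INR b)).
  by move: x1 y1 => /=; lra.
have -> : (1 - l) * p.2 + l * q.2 - ((1 - u) * r.2 + u * s.2) =
  (1 - u) * (t * (INR c * INR c)) + u * (t * (INR d * INR d)) -
  ((1 - l) * (t * (INR a * INR a)) + l * (t * (INR b * INR b))).
  by move: x2 y2 => /=; lra.
have sq y : 0 <= INR y * INR y by have := pos_INR y; nra.
have := bnd _ _ _ _ (pos_INR a) (pos_INR b) (pos_INR c) (pos_INR d).
have := bnd _ _ _ _ (sq a) (sq b) (sq c) (sq d).
rewrite /K in tK; lra.
Qed.

Lemma chain_all_false (T : Type) (x0 : T) (g : T -> T -> bool) x s :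
  (forall n, (n < size s)%N -> g (nth x0 (x :: s) n) (nth x0 (x :: s) n.+1) = false) ->
  chain g x s = false.
Proof.
elim: s x => //= y s IH x h; rewrite (h 0%N) // IH // => n ns.
exact: (h n.+1).
Qed.

Section K5.
Variables (q : nat -> pt) (C : nat -> nat -> seq pt).

Let poly_chain i j := q i :: rcons (C i j) (q j).

(* Vertex [i] has label [i]; the [m]-th inner point of the chain [i j] has label
   [5 + 25 m + 5 i + j], so that all labels are distinct. *)
Let label (i j m : nat) : nat := (5 + (25 * m + (5 * i + j)))%N.

Let label_chain (i j : nat) : seq nat := [seq label i j m | m <- iota 0 (size (C i j))].

Let point (n : nat) : pt :=
  if (n < 5)%N then q n else
  nth p0 (C ((n - 5) %% 25 %/ 5) ((n - 5) %% 25 %% 5)) ((n - 5) %/ 25).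

Let labelK i j m : (i < 5)%N -> (j < 5)%N ->
  [/\ (label i j m - 5) %/ 25 = m, (label i j m - 5) %% 25 %/ 5 = i &
      (label i j m - 5) %% 25 %% 5 = j]%N.
Proof.
move=> i5 j5; rewrite /label addKn (mulnC 25%N) (mulnC 5%N).
have lt : (i * 5 + j < 25)%N.
  by apply: leq_trans (leq_mul i5 (leqnn 5)); rewrite mulSnr ltn_add2l.
rewrite divnMDl // (divn_small lt) addn0 modnMDl (modn_small lt).
by rewrite divnMDl // (divn_small j5) addn0 modnMDl (modn_small j5).
Qed.

Let map_point i j : (i < 5)%N -> (j < 5)%N ->
  map point (i :: rcons (label_chain i j) j) = poly_chain i j.
Proof.
move=> i5 j5; rewrite /= map_rcons /poly_chain /point i5 j5; congr (_ :: rcons _ _).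
rewrite -map_comp -[RHS](mkseq_nth p0); apply: eq_map => m /=.
by have [-> -> ->] := labelK m i5 j5.
Qed.

Let uniq_label_chain i j : (i < j < 5)%N -> uniq (i :: rcons (label_chain i j) j).
Proof.
move=> /andP[ij j5]; have i5 := ltn_trans ij j5.
have notin k : (k < 5)%N -> k \notin label_chain i j.
  by move=> k5; apply/mapP => -[m _ km]; move: k5; rewrite km.
rewrite /= mem_rcons in_cons negb_or neq_ltn ij notin //= rcons_uniq notin //=.
rewrite map_inj_uniq ?iota_uniq // => m m'.
by have [e _ _] := labelK m i5 j5; have [e' _ _] := labelK m' i5 j5; move=> h; rewrite -e h.
Qed.

Let disjoint_label_chain i j k l : (i < j < 5)%N -> (k < l < 5)%N -> uniq [:: i; j; k; l] ->
  ~~ has (mem (i :: rcons (label_chain i j) j)) (k :: rcons (label_chain k l) l).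
Proof.
move=> /andP[ij j5] /andP[kl l5]; have i5 := ltn_trans ij j5; have k5 := ltn_trans kl l5.
rewrite /= !inE !negb_or !andbT => /and3P[/and3P[_ ik il] /andP[jk jl] _].
have notin a b m : (m < 5)%N -> m \notin label_chain a b.
  by move=> m5; apply/mapP => -[m' _ e]; move: m5; rewrite e.
rewrite mem_rcons has_rcons /= !inE !mem_rcons !inE !negb_or.
rewrite (eq_sym k) ik (eq_sym k) jk (eq_sym l) il (eq_sym l) jl !notin //=.
apply/hasPn => _ /mapP[m _ ->] /=; rewrite inE mem_rcons inE !negb_or.
apply/and3P; split; try by apply/eqP => e; move: i5 j5; rewrite -e.
apply/mapP => -[m' _ e]; have [_ e1 _] := labelK m k5 l5; have [_ e2 _] := labelK m' i5 j5.
by move: ik; rewrite -e1 -e2 e eqxx.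
Qed.

(** If independent chains were disjoint, a small generic shift would keep them disjoint segment by
    segment. All fifteen parities would then be even, against [total_parity_odd]. *)
Lemma K5_chains_meet : ~ (forall i j k l, (i < j < 5)%N -> (k < l < 5)%N ->
  uniq [:: i; j; k; l] -> forall x, on_arc (poly_chain i j) x -> ~ on_arc (poly_chain k l) x).
Proof.
move=> dis.
(* A finite list of labels, so that a single [t] works for all triples and quadruples at once. *)
pose S :=
  flatten [seq flatten [seq i :: rcons (label_chain i j) j | j <- iota 0 5] | i <- iota 0 5].
have inS i j n : (i < 5)%N -> (j < 5)%N -> n \in i :: rcons (label_chain i j) j -> n \in S.
  move=> i5 j5 hn; apply/flatten_mapP; exists i; first by rewrite mem_iota.
  by apply/flatten_mapP; exists j; first by rewrite mem_iota.
pose Pt t n := moment_shift t n (point n).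
have [e1 [e10 h1]] : for_small (fun t => forall a, a \in S -> forall b, b \in S ->
    forall c, c \in S -> a != b -> a != c -> b != c -> det3 (Pt t a) (Pt t b) (Pt t c) <> 0).
  do 3!(apply: for_small_all => ? _).
  by do 3!(apply: for_small_imp => ?); exact: generic_moment_shift.
have [e2 [e20 h2]] : for_small (fun t => forall a, a \in S -> forall b, b \in S ->
    forall c, c \in S -> forall d, d \in S ->
    (forall x, on_seg (point a) (point b) x -> ~ on_seg (point c) (point d) x) ->
    forall x, on_seg (Pt t a) (Pt t b) x -> ~ on_seg (Pt t c) (Pt t d) x).
  do 4!(apply: for_small_all => ? _).
  by apply: for_small_imp; exact: disjoint_moment_shift.
pose t := Rmin e1 e2 / 2.
have [t1 t2] : 0 < t < e1 /\ 0 < t < e2.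
  have := Rmin_pos _ _ e10 e20; have := Rmin_l e1 e2; have := Rmin_r e1 e2.
  by rewrite /t; split; lra.
have gp a b c : a \in S -> b \in S -> c \in S -> a != b -> a != c -> b != c ->
    det3 (Pt t a) (Pt t b) (Pt t c) <> 0 by move=> *; apply: h1.
have adm : admissible [in S] id label_chain.
  split=> [i j ij|i j k l ij kl u]; last exact: disjoint_label_chain.
  split; first exact: uniq_label_chain.
  have /andP[lt j5] := ij; have i5 := ltn_trans lt j5.
  by apply/allP => n /(inS _ _ _ i5 j5).
suff zero i j k l : (i < j < 5)%N -> (k < l < 5)%N -> uniq [:: i; j; k; l] ->
    cross_parity (Pt t) id label_chain i j k l = false.
  by have := total_parity_odd gp adm; rewrite /total_parity !zero.
move=> ij kl u; have /andP[lt j5] := ij; have i5 := ltn_trans lt j5.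
have /andP[lt' l5] := kl; have k5 := ltn_trans lt' l5.
apply: (@chain_all_false _ 0%N) => n; rewrite /edge_chain => hn.
apply: (@chain_all_false _ 0%N) => n' hn'.
set a := nth _ _ n; set b := nth _ _ n.+1; set c := nth _ _ n'; set d := nth _ _ n'.+1.
have ha : a \in i :: rcons (label_chain i j) j by rewrite mem_nth //= ltnW.
have hb : b \in i :: rcons (label_chain i j) j by rewrite mem_nth.
have hc : c \in k :: rcons (label_chain k l) l by rewrite mem_nth //= ltnW.
have hd : d \in k :: rcons (label_chain k l) l by rewrite mem_nth.
have /hasPn dl := disjoint_label_chain ij kl u.
have nab : a != b by rewrite nth_uniq ?uniq_label_chain ?neq_ltn ?ltnSn //; exact: ltnW.
have ncd : c != d by rewrite nth_uniq ?uniq_label_chain ?neq_ltn ?ltnSn //; exact: ltnW.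
have ne x y : x \in i :: rcons (label_chain i j) j -> y \in k :: rcons (label_chain k l) l ->
   (x != y) && (y != x).
  by move=> hx /dl /= hy; rewrite (eq_sym y) andbb; apply: contraNneq hy => <-.
have [ac ca] := andP (ne _ _ ha hc); have [ad da] := andP (ne _ _ ha hd).
have [bc cb] := andP (ne _ _ hb hc); have [bd db] := andP (ne _ _ hb hd).
have Sa := inS _ _ _ i5 j5 ha; have Sb := inS _ _ _ i5 j5 hb.
have Sc := inS _ _ _ k5 l5 hc; have Sd := inS _ _ _ k5 l5 hd.
apply/negP => cr.
have [|||| x [x1 x2]] := crosses_meet _ _ _ _ cr; try by apply: gp.
apply: (h2 t t2 a Sa b Sb c Sc d Sd _ x x1 x2) => y y1 y2.
apply: (dis i j k l ij kl u y).
  exists n; rewrite -map_point // size_map !(nth_map 0%N) //= ltnW //.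
exists n'; rewrite -map_point // size_map !(nth_map 0%N) //= ltnW //.
Qed.

End K5.

(** * Paths in plane graphs *)

Lemma on_seg_sym (a b x : pt) : on_seg a b x -> on_seg b a x.
Proof. by move=> [l [hl [e1 e2]]]; exists (1 - l); split; [lra | split; lra]. Qed.

Lemma on_seg_diag (a x : pt) : on_seg a a x -> x = a.
Proof. by case: a x => a1 a2 [x1 x2] [l [_ /= [-> ->]]]; congr (_, _); ring. Qed.

Lemma on_arc_rev (s : seq pt) x : on_arc (rev s) x -> on_arc s x.
Proof.
move=> [n]; rewrite size_rev => -[hn]; rewrite !nth_rev ?(ltnW hn) // => /on_seg_sym h.
(* Segment [n] of the reversed list joins entries [size s - n.+1] and [size s - n.+2] of [s]. *)
exists (size s - n.+2)%N; have -> : (size s - n.+2).+1 = (size s - n.+1)%N by rewrite -subSn.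
by split=> //; rewrite ltn_subrL (leq_ltn_trans _ hn).
Qed.

Lemma on_arc_cat (s1 s2 : seq pt) x : on_arc (s1 ++ s2) x ->
  [\/ on_arc s1 x, on_arc s2 x | on_seg (last p0 s1) (head p0 s2) x].
Proof.
elim: s1 => [|a s1 IH]; first by constructor 2.
case=> -[|n] [/= hn h].
  case: s1 IH hn h => [|b s1] IH hn h; first by constructor 3; rewrite -nth0.
  by constructor 1; exists 0%N.
have [|[m [hm hs]]|h2|h3] := IH; first by exists n.
- by constructor 1; exists m.+1.
- by constructor 2.
- case: s1 IH hn h h3 => [|b s1] IH hn h h3; last by constructor 3.
  by constructor 2; exists n.
Qed.

Definition inner_points (s : seq pt) : seq pt := behead (belast (head p0 s) (behead s)).

Lemma inner_pointsE (s : seq pt) :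
  (2 <= size s)%N -> head p0 s :: rcons (inner_points s) (last p0 s) = s.
Proof.
by case: s => [|a s] //; case/lastP: s => [|s b] // _;
  rewrite /inner_points /= belast_rcons last_rcons.
Qed.

Section PlanePaths.
Variables (N : nat) (adj : rel 'I_N) (pos : 'I_N -> pt) (arc : 'I_N -> 'I_N -> seq pt).
Hypotheses (adj_graph : simple_graph adj) (emb : plane_embedding adj pos arc).

Let dart (x y : 'I_N) : seq pt := if (x < y)%N then arc x y else rev (arc y x).

Let dartP x y : adj x y ->
  [/\ (2 <= size (dart x y))%N, head p0 (dart x y) = pos x, last p0 (dart x y) = pos y &
      forall z, on_arc (dart x y) z ->
        exists u w, [/\ adj u w, (u < w)%N, u \in [:: x; y], w \in [:: x; y] & on_arc (arc u w) z]].
Proof.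
have [sym irr] := adj_graph; have [_ [h _]] := emb => xy; rewrite /dart.
case: (ltngtP x y) => [lt|lt|/val_inj e]; last by rewrite e irr in xy.
  have [[sz _] [hd la]] := h x y xy lt; split=> // z hz.
  by exists x, y; rewrite !inE !eqxx orbT.
have yx : adj y x by rewrite sym.
have [[sz _] [hd la]] := h y x yx lt; rewrite size_rev; split=> // [||z /on_arc_rev hz].
- by move: la; case/lastP: (arc y x) => // s b; rewrite rev_rcons last_rcons.
- by move: hd; case: (arc y x) => // b s; rewrite rev_cons last_rcons.
by exists y, x; rewrite !inE !eqxx orbT.
Qed.

(** The end of each dart is repeated as the next point, which creates degenerate segments. The
    labelled perturbation tolerates them. *)
Fixpoint path_curve (x : 'I_N) (p : seq 'I_N) : seq pt :=
  if p is y :: p' then dart x y ++ path_curve y p' else [:: pos x].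

(** The last clause is what matters: the curve stays inside arcs of edges with both ends on the
    path, so vertex-disjoint paths have curves inside arcs of vertex-disjoint edges. *)
Lemma path_curveP x p : path adj x p -> p != [::] ->
  [/\ (2 <= size (path_curve x p))%N, head p0 (path_curve x p) = pos x,
      last p0 (path_curve x p) = pos (last x p) &
      forall z, on_arc (path_curve x p) z ->
        exists u w, [/\ adj u w, (u < w)%N, u \in x :: p, w \in x :: p & on_arc (arc u w) z]].
Proof.
elim: p x => //= y p IH x /andP[xy yp] _.
have [sz hd la on] := dartP xy.
have mem2 u : u \in [:: x; y] -> u \in [:: x, y & p].
  by rewrite !inE => /orP[] ->; rewrite ?orbT.
(* Needed for the degenerate segment at the junction: [pos y] is the end, at parameter 1, of the
   last segment of the dart. *)
have on_y : exists u w, [/\ adj u w, (u < w)%N, u \in [:: x; y], w \in [:: x; y] &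
    on_arc (arc u w) (pos y)].
  apply: on; exists (size (dart x y) - 2)%N; rewrite -la -nth_last.
  rewrite -subSn // subSS subn1; split; first by rewrite ltn_predL ltnW.
  by exists 1; split; [lra | split; lra].
have rest z : on_arc (path_curve y p) z -> exists u w,
    [/\ adj u w, (u < w)%N, u \in [:: x, y & p], w \in [:: x, y & p] & on_arc (arc u w) z].
  case: (altP (p =P [::])) => [->|pn0]; first by case=> n [].
  have [_ _ _ h] := IH y yp pn0 => /h [u [w [a1 a2 a3 a4 a5]]].
  by exists u, w; rewrite !(in_cons x) a3 a4 !orbT.
have hdl : head p0 (path_curve y p) = pos y /\ last p0 (path_curve y p) = pos (last y p).
  case: (altP (p =P [::])) => [->|pn0] //.
  by have [_ h1 h2 _] := IH y yp pn0.
case: hdl => hd' la'.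
have cn0 : (0 < size (path_curve y p))%N.
  case: (altP (p =P [::])) => [->|pn0] //.
  by have [+ _ _ _] := IH y yp pn0; exact: ltnW.
split.
- by rewrite size_cat; apply: leq_trans (leq_addr _ _).
- by case: (dart x y) sz hd.
- by rewrite last_cat -la'; case: path_curve cn0.
move=> z /on_arc_cat [h|h|h].
- by have [u [w [a1 a2 a3 a4 a5]]] := on z h; exists u, w; split=> //; apply: mem2.
- exact: rest.
- move: h; rewrite la hd' => /on_seg_diag ->.
  by have [u [w [a1 a2 a3 a4 a5]]] := on_y; exists u, w; split=> //; apply: mem2.
Qed.

(** The embedding separates an arc from the interior of another. A common point must therefore be an
    end of the first arc, then an end of the second because vertices avoid arc interiors, and [pos]
    is injective. *)
Lemma arcs_disjoint x y x' y' z :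
  adj x y -> (x < y)%N -> adj x' y' -> (x' < y')%N ->
  x != x' -> x != y' -> y != x' -> y != y' ->
  on_arc (arc x y) z -> ~ on_arc (arc x' y') z.
Proof.
have [inj [ends [avoid cross]]] := emb.
move=> xy lt xy' lt' /eqP n1 /eqP n2 /eqP n3 /eqP n4 h1 h2.
have [_ [hd la]] := ends _ _ xy lt; have [_ [hd' la']] := ends _ _ xy' lt'.
have ne : (x, y) <> (x', y') by case.
have end1 : z = pos x \/ z = pos y.
  apply: NNPP => /not_or_and [a b]; apply: (cross _ _ _ _ xy lt xy' lt' ne z) => //.
  by split=> //; rewrite hd la.
have end2 : z = pos x' \/ z = pos y'.
  apply: NNPP => /not_or_and [a b].
  have int : arc_interior (arc x' y') z by split=> //; rewrite hd' la'.
  by case: end1 => e; [apply: (avoid x' y' x) | apply: (avoid x' y' y)]; rewrite -?e.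
by case: end1 end2 => -> [] /inj.
Qed.

Lemma K5_paths_meet (v : nat -> 'I_N) (p : nat -> nat -> seq 'I_N) :
  (forall i j, (i < j < 5)%N -> v i != v j) ->
  (forall i j, (i < j < 5)%N -> simple_path adj (v i) (v j) (p i j)) ->
  exists i j k l u, [/\ (i < j < 5)%N, (k < l < 5)%N, uniq [:: i; j; k; l],
    u \in v i :: p i j & u \in v k :: p k l].
Proof.
move=> vinj vp; apply: NNPP => no.
pose C i j := inner_points (path_curve (v i) (p i j)).
have curve i j : (i < j < 5)%N -> pos (v i) :: rcons (C i j) (pos (v j)) =
    path_curve (v i) (p i j) /\ forall z, on_arc (path_curve (v i) (p i j)) z ->
    exists u w, [/\ adj u w, (u < w)%N, u \in v i :: p i j, w \in v i :: p i j &
      on_arc (arc u w) z].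
  move=> ij; have /and3P[h1 /eqP h2 h3] := vp i j ij.
  have pn0 : p i j != [::].
    by apply: contraNneq (vinj i j ij) => e; rewrite -h2 e.
  have [sz hd la on] := path_curveP h1 pn0; split=> //.
  by rewrite -[RHS]inner_pointsE // hd la h2.
apply: (@K5_chains_meet (fun i => pos (v i)) C) => i j k l ij kl u x.
have [-> on1] := curve i j ij; have [-> on2] := curve k l kl.
move=> /on1 [a [b [ab lab ha hb hx]]] /on2 [c [d [cd lcd hc hd hx']]].
have ne y z : y \in v i :: p i j -> z \in v k :: p k l -> y != z.
  move=> hy hz; apply/eqP => e; apply: no; exists i, j, k, l, y; split=> //.
  by rewrite e.
exact: (arcs_disjoint ab lab cd lcd (ne _ _ ha hc) (ne _ _ ha hd) (ne _ _ hb hc)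
  (ne _ _ hb hd) hx hx').
Qed.

End PlanePaths.

(** * Sums and averaging *)

HB.instance Definition _ :=
  Monoid.isComLaw.Build R 0 Rplus (fun x y z => esym (Rplus_assoc x y z)) Rplus_comm Rplus_0_l.
HB.instance Definition _ := Monoid.isMulLaw.Build R 0 Rmult Rmult_0_l Rmult_0_r.
HB.instance Definition _ :=
  Monoid.isAddLaw.Build R Rmult Rplus (fun x y z => Rmult_plus_distr_r x y z) Rmult_plus_distr_l.

Local Notation "\sum_ ( i <- r | P ) F" := (\big[Rplus/0]_(i <- r | P%B) F) : R_scope.
Local Notation "\sum_ ( i <- r ) F" := (\big[Rplus/0]_(i <- r) F) : R_scope.
Local Notation "\sum_ ( i | P ) F" := (\big[Rplus/0]_(i | P%B) F) : R_scope.
Local Notation "\sum_ ( i 'in' A ) F" := (\big[Rplus/0]_(i in A) F) : R_scope.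
Local Notation "\sum_ ( i : t ) F" := (\big[Rplus/0]_(i : t) F) (only parsing) : R_scope.
Local Notation "\sum_ i F" := (\big[Rplus/0]_i F) : R_scope.

Lemma RsumE (s : seq R) : Rsum s = \sum_(x <- s) x.
Proof. by elim: s => [|x s IH]; rewrite ?big_nil // big_cons -IH. Qed.

Lemma sum_nonneg (I : Type) (r : seq I) (P : pred I) (F : I -> R) :
  (forall i, P i -> 0 <= F i) -> 0 <= \sum_(i <- r | P i) F i.
Proof. by move=> h; elim/big_ind: _ => //; [lra | move=> *; lra]. Qed.

Lemma sum_le (I : Type) (r : seq I) (P : pred I) (F G : I -> R) :
  (forall i, P i -> F i <= G i) -> \sum_(i <- r | P i) F i <= \sum_(i <- r | P i) G i.
Proof. by move=> h; elim/big_ind2: _ => //; [lra | move=> *; lra]. Qed.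

Lemma sum_le_cond (I : Type) (r : seq I) (P : pred I) (F : I -> R) :
  (forall i, 0 <= F i) -> \sum_(i <- r | P i) F i <= \sum_(i <- r) F i.
Proof.
move=> h; rewrite big_mkcond; apply: sum_le => i _; case: (P i) => //; lra.
Qed.

Lemma sum_const (I : finType) (P : pred I) (x : R) : \sum_(i | P i) x = INR #|P| * x.
Proof. by rewrite big_const; elim: #|P| => [|n IH]; rewrite ?S_INR /= ?IH; lra. Qed.

Lemma term_le_sum (I : finType) (F : I -> R) (i : I) :
  (forall j, 0 <= F j) -> F i <= \sum_j F j.
Proof.
move=> h; rewrite (bigD1 i) //=; have := @sum_nonneg _ (index_enum I) (fun j => j != i) F.
by move=> /(_ (fun j _ => h j)); lra.
Qed.

Lemma sum_inj_le (I J : finType) (h : I -> J) (G : J -> R) :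
  injective h -> (forall y, 0 <= G y) -> \sum_i G (h i) <= \sum_y G y.
Proof.
move=> inj h0; have -> : \sum_i G (h i) = \sum_(y in h @: setT) G y.
  by rewrite big_imset /=; [apply: eq_bigl => i; rewrite inE | move=> x y _ _ /inj].
exact: sum_le_cond.
Qed.

Section Derandomize.
Variables (E U : finType) (c : E -> E -> R).
Hypothesis c_diag : forall e, c e e = 0.

Definition dot (a b : U -> R) : R := \sum_u a u * b u.

Definition energy (b : E -> U -> R) : R := \sum_e \sum_f c e f * dot (b e) (b f).

Definition update (b : E -> U -> R) (e : E) (x : U -> R) : E -> U -> R :=
  fun f => if f == e then x else b f.

Lemma dotC a b : dot a b = dot b a.
Proof. by apply: eq_bigr => u _; rewrite Rmult_comm. Qed.

(** Because [c e e = 0] there is no term quadratic in [x]: the energy is a linear form in [x] plus a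
    part that does not involve [e]. *)
Lemma energy_update b e x :
  energy (update b e x) =
  dot x (fun u => \sum_(f | f != e) (c e f + c f e) * b f u) +
  \sum_(g | g != e) \sum_(f | f != e) c g f * dot (b g) (b f).
Proof.
have upd_e : update b e x e = x by rewrite /update eqxx.
have upd_n f : f != e -> update b e x f = b f by rewrite /update => /negbTE ->.
rewrite /energy (bigD1 e) //= (bigD1 e) //= c_diag upd_e Rmult_0_l Rplus_0_l.
have -> : \sum_(g | g != e) \sum_f c g f * dot (update b e x g) (update b e x f) =
   \sum_(g | g != e) (c g e * dot x (b g) + \sum_(f | f != e) c g f * dot (b g) (b f)).
  apply: eq_bigr => g ge; rewrite (bigD1 e) //= upd_e upd_n // dotC; congr Rplus.
  by apply: eq_bigr => f fe; rewrite upd_n.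
rewrite big_split /= -Rplus_assoc; congr Rplus.
rewrite -big_split /= /dot.
under [RHS]eq_bigr do rewrite big_distrr /=.
rewrite exchange_big /=; apply: eq_bigr => f fe; rewrite upd_n // -Rmult_plus_distr_r.
by rewrite big_distrr /=; apply: eq_bigr => u _; ring.
Qed.

(* The energy is affine in each argument separately, so averages can be replaced by
   extreme points one argument at a time without increasing it. *)
Lemma derandomize (a : E -> U -> R) (Good : E -> (U -> R) -> Prop) :
  (forall e w, exists x, Good e x /\ dot x w <= dot (a e) w) ->
  exists b, (forall e, Good e (b e)) /\ energy b <= energy a.
Proof.
move=> good.
(* The clause on untouched arguments keeps them equal to [a], the vectors to which the hypothesis
   [good] applies. *)
suff [b [h1 [_ h3]]] : exists b, (forall e, e \in enum E -> Good e (b e)) /\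
    (forall e, e \notin enum E -> b e = a e) /\ energy b <= energy a.
  by exists b; split=> // e; apply: h1; rewrite mem_enum.
elim: (enum E) => [|e s [b [h1 [h2 h3]]]]; first by exists a; split=> //; split=> //; lra.
case: (boolP (e \in s)) => es.
  exists b; split; first by move=> f; rewrite in_cons => /orP[/eqP ->|]; apply: h1.
  by split=> // f; rewrite in_cons negb_or => /andP[_]; apply: h2.
have [x [gx hx]] := good e (fun u => \sum_(f | f != e) (c e f + c f e) * b f u).
exists (update b e x); split.
  move=> f; rewrite in_cons /update; case: eqP => [-> //|_ /=]; exact: h1.
split; first by move=> f; rewrite in_cons negb_or /update => /andP[/negbTE -> fs]; apply: h2.
apply: Rle_trans h3.
have -> : energy b = energy (update b e (b e)).
  have u f : update b e (b e) f = b f by rewrite /update; case: eqP => [->|].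
  by apply: eq_bigr => g _; apply: eq_bigr => f _; rewrite !u.
by rewrite !energy_update h2 //; lra.
Qed.

End Derandomize.

Lemma exists_le_average (X : Type) (mu : seq (X * R)) (phi : X -> R) :
  (forall e, List.In e mu -> 0 <= e.2) -> Rsum (map snd mu) = 1 ->
  exists e, List.In e mu /\ phi e.1 <= Rsum [seq x.2 * phi x.1 | x <- mu].
Proof.
move=> h0 h1; apply: NNPP => no; set A := Rsum [seq _ | x <- mu] in no.
have lt e : List.In e mu -> A < phi e.1.
  by move=> he; apply: Rnot_le_lt => le; apply: no; exists e.
(* A sublist may have total weight 0, so the strict inequality is claimed only for positive weight;
   the full list has weight 1. *)
have key nu : (forall e, List.In e nu -> 0 <= e.2 /\ A < phi e.1) ->
    let S := Rsum (map snd nu) in let T := Rsum [seq x.2 * phi x.1 | x <- nu] in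
    [/\ 0 <= S, A * S <= T & 0 < S -> A * S < T].
  elim: nu => [|e nu IH] h /=; first by split; lra.
  have [|s0 le lt'] := IH; first by move=> x hx; apply: h; right.
  have [e0 eA] := h e (or_introl erefl).
  by split; [lra | nra | move=> s1; case: (Req_dec e.2 0) => z; [rewrite z in s1 *|]; nra].
have [|_ _] := key mu; first by move=> e he; split; [exact: h0|exact: lt].
rewrite h1 -/A; lra.
Qed.

(** * Vertex flows *)

Section Flow.
Variables (N : nat) (adj : rel 'I_N) (rt : 'I_N -> 'I_N -> seq (seq 'I_N * R)).
Hypothesis rtP : routing adj rt.

Definition pair_flow (s t u : 'I_N) : R :=
  if (s < t)%N then Rsum [seq e.2 | e <- rt s t & u \in s :: e.1] else 0.

Lemma vertex_flowE u : vertex_flow rt u = \sum_s \sum_t pair_flow s t u.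
Proof.
rewrite /vertex_flow RsumE big_map big_filter big_mkcond big_allpairs big_enum /=.
by apply: eq_bigr => s _; rewrite big_enum.
Qed.

Lemma Rsum_filter_bounds (X : Type) (mu : seq (X * R)) (P : pred X) :
  (forall e, List.In e mu -> 0 <= e.2) ->
  0 <= Rsum [seq e.2 | e <- mu & P e.1] <= Rsum (map snd mu).
Proof.
elim: mu => [|e mu IH] h /=; first lra.
have {IH} : 0 <= Rsum [seq e.2 | e <- mu & P e.1] <= Rsum (map snd mu).
  by apply: IH => x hx; apply: h; right.
by have := h e (or_introl erefl); case: (P e.1) => /=; lra.
Qed.

Lemma pair_flow_bounds s t u : 0 <= pair_flow s t u <= 1.
Proof.
rewrite /pair_flow; case: ltnP => [st|_]; last lra.
have [h <-] := rtP st; apply: (@Rsum_filter_bounds _ _ (fun p => u \in s :: p)).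
by move=> e /h [].
Qed.

Lemma vertex_flow_ge0 u : 0 <= vertex_flow rt u.
Proof.
rewrite vertex_flowE; apply: sum_nonneg => s _; apply: sum_nonneg => t _.
by have [] := pair_flow_bounds s t u.
Qed.

Lemma vertex_flow_le_max u : vertex_flow rt u <= max_vertex_flow rt.
Proof.
rewrite /max_vertex_flow; have := mem_enum 'I_N u; rewrite inE.
elim: (enum 'I_N) => //= v s IH; rewrite in_cons => /orP[/eqP <-|/IH h].
  exact: Rmax_l.
exact: Rle_trans h (Rmax_r _ _).
Qed.

Lemma max_vertex_flow_ge0 : 0 <= max_vertex_flow rt.
Proof.
rewrite /max_vertex_flow; elim: (enum 'I_N) => [|v s IH] /=; first lra.
exact: Rle_trans IH (Rmax_r _ _).
Qed.

Lemma max_vertex_flow_le B :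
  0 <= B -> (forall u, vertex_flow rt u <= B) -> max_vertex_flow rt <= B.
Proof.
move=> B0 h; rewrite /max_vertex_flow; elim: (enum 'I_N) => //= v s IH.
exact: Rmax_lub.
Qed.

Lemma sum_ltn_pairs : \sum_(s : 'I_N) \sum_(t : 'I_N) (if (s < t)%N then 1 else 0) =
  INR N * (INR N - 1) / 2.
Proof.
set A := LHS.
have A' : A = \sum_(s : 'I_N) \sum_(t : 'I_N) (if (t < s)%N then 1 else 0).
  by rewrite /A exchange_big.
have D : \sum_(s : 'I_N) \sum_(t : 'I_N) (if t == s then 1 else 0) = INR N.
  under eq_bigr do rewrite -big_mkcond big_pred1_eq.
  by rewrite sum_const card_ord; lra.
have : \sum_(s : 'I_N) \sum_(t : 'I_N) 1 = INR N * INR N.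
  under eq_bigr do rewrite sum_const card_ord.
  by rewrite sum_const card_ord; lra.
have -> : \sum_(s : 'I_N) \sum_(t : 'I_N) 1 = A + A + INR N.
  rewrite -D {2}A' /A -!big_split; apply: eq_bigr => s _ /=.
  rewrite -!big_split; apply: eq_bigr => t _ /=.
  by rewrite -(inj_eq val_inj) /=; case: ltngtP => _; lra.
lra.
Qed.

Lemma max_vertex_flow_upper : max_vertex_flow rt <= INR N * (INR N - 1) / 2.
Proof.
have ge0 : 0 <= INR N * (INR N - 1) / 2.
  by rewrite -sum_ltn_pairs; do 2!(apply: sum_nonneg => ? _); case: ifP => _; lra.
apply: max_vertex_flow_le => // u; rewrite vertex_flowE -sum_ltn_pairs.
apply: sum_le => s _; apply: sum_le => t _; have := pair_flow_bounds s t u.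
by rewrite /pair_flow; case: ifP => _; lra.
Qed.

(** Every path of a pair visits its starting vertex. This bound covers [N < 5], where no five
    vertices are available. *)
Lemma max_vertex_flow_ge1 : (2 <= N)%N -> 1 <= max_vertex_flow rt.
Proof.
move=> N2; pose s : 'I_N := Ordinal (ltnW N2); pose t : 'I_N := Ordinal N2.
apply: Rle_trans (vertex_flow_le_max s).
have -> : 1 = pair_flow s t s.
  rewrite /pair_flow /=; have [_ <-] := rtP (isT : (s < t)%N).
  by congr Rsum; elim: (rt s t) => //= e l ->.
rewrite vertex_flowE; apply: Rle_trans (term_le_sum (F := fun x => pair_flow s x s) t _) _.
  by move=> x; have [] := pair_flow_bounds s x s.
apply: (term_le_sum (F := fun y => \sum_x pair_flow y x s) s) => y.
by apply: sum_nonneg => x _; have [] := pair_flow_bounds y x s.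
Qed.

(** The flow of a pair is the average of the indicator vectors of its paths, weighted by their
    amounts. *)
Lemma pair_flow_dot (s t : 'I_N) (w : 'I_N -> R) : (s < t)%N ->
  dot (pair_flow s t) w =
  Rsum [seq e.2 * dot (fun u => if u \in s :: e.1 then 1 else 0) w | e <- rt s t].
Proof.
move=> st; rewrite /dot /pair_flow st; elim: (rt s t) => [|e l IH].
  by rewrite /= big1 // => u _; rewrite /=; ring.
rewrite /= -IH big_distrr -big_split /=; apply: eq_bigr => u _.
by case: ifP => _ /=; ring.
Qed.

Lemma path_below_pair_flow (s t : 'I_N) (w : 'I_N -> R) : (s < t)%N ->
  exists p, simple_path adj s t p /\
    dot (fun u => if u \in s :: p then 1 else 0) w <= dot (pair_flow s t) w.
Proof.
move=> st; have [h h1] := rtP st.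
have [|e [he le]] := @exists_le_average _ (rt s t)
  (fun p => dot (fun u => if u \in s :: p then 1 else 0) w) _ h1.
  by move=> e /h [].
by exists e.1; rewrite pair_flow_dot //; split=> //; have [] := h e he.
Qed.

Hypotheses (adj_graph : simple_graph adj) (adj_planar : planar adj).

Definition independent (e f : 'I_5 * 'I_5) : bool :=
  [&& (e.1 < e.2)%N, (f.1 < f.2)%N & uniq [:: e.1; e.2; f.1; f.2]].

Definition independence (e f : 'I_5 * 'I_5) : R := if independent e f then 1 else 0.

Definition tuple_flow (t : 5.-tuple 'I_N) (e : 'I_5 * 'I_5) : 'I_N -> R :=
  pair_flow (tnth t e.1) (tnth t e.2).

(** After derandomization each edge carries the indicator of one path. The vertex shared by two
    independent paths contributes 1, and all other terms are nonnegative. Sortedness matches [i < j]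
    with the orientation in which [rt] is specified. *)
Lemma energy_ge1 (t : 5.-tuple 'I_N) :
  sorted ltn (map val t) -> 1 <= energy independence (tuple_flow t).
Proof.
move=> st; have [pos [arc emb]] := adj_planar.
have lt_t (i j : 'I_5) : (i < j)%N -> (tnth t i < tnth t j)%N.
  have val_t (x : 'I_5) : tnth t x = nth 0%N (map val t) x :> nat.
    by rewrite (nth_map (tnth t x)) ?size_tuple // -tnth_nth.
  by move=> ij; rewrite !val_t (sorted_ltn_nth ltn_trans) ?inE ?size_map ?size_tuple.
pose ind (s : 'I_N) p (u : 'I_N) : R := if u \in s :: p then 1 else 0.
(* For [e.1 >= e.2] any vector is allowed, since [independence] gives it weight 0. *)
pose Good (e : 'I_5 * 'I_5) (x : 'I_N -> R) := (e.1 < e.2)%N ->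
  exists p, simple_path adj (tnth t e.1) (tnth t e.2) p /\ x = ind (tnth t e.1) p.
have diag e : independence e e = 0.
  by rewrite /independence /independent /= !inE eqxx !orbT !andbF.
have [e w|b [good le]] := @derandomize _ _ _ diag (tuple_flow t) Good.
  case: (ltnP e.1 e.2) => [lt|ge]; last first.
    by exists (tuple_flow t e); split; [move=> lt; rewrite ltnNge ge in lt | lra].
  have [p [sp le]] := path_below_pair_flow w (lt_t _ _ lt).
  by exists (ind (tnth t e.1) p); split=> // _; exists p.
apply: Rle_trans le.
have dot_ge0 e f : independent e f -> forall u, 0 <= b e u * b f u.
  case/and3P=> /good [p [_ ->]] /good [p' [_ ->]] _ u; rewrite /ind.
  by case: ifP => _; case: ifP => _; lra.
have term_ge0 e f : 0 <= independence e f * dot (b e) (b f).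
  rewrite /independence; case: ifP => [ef|_]; last lra.
  by rewrite Rmult_1_l; apply: sum_nonneg => u _; apply: dot_ge0.
have [p0 hp0] : exists p : 'I_5 * 'I_5 -> seq 'I_N,
    forall e : 'I_5 * 'I_5, (e.1 < e.2)%N ->
    simple_path adj (tnth t e.1) (tnth t e.2) (p e) /\ b e = ind (tnth t e.1) (p e).
  have ex (e : 'I_5 * 'I_5) : exists p, (e.1 < e.2)%N ->
    simple_path adj (tnth t e.1) (tnth t e.2) p /\ b e = ind (tnth t e.1) p.
    by case: (boolP (e.1 < e.2)%N) => [/good [p h]|_]; [exists p | exists [::]].
  by have [p h] := fin_all_exists ex; exists p.
pose v (i : nat) := tnth t (inord i).
have inordE i : (i < 5)%N -> @inord 4 i = i :> nat by move=> ?; rewrite inordK.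
have bnd i j : (i < j < 5)%N -> (@inord 4 i < @inord 4 j)%N.
  by move=> /andP[ij j5]; rewrite !inordE // (ltn_trans ij).
have [||i [j [k [l [u [ij kl uq ui uk]]]]]] :=
  @K5_paths_meet N adj pos arc adj_graph emb v (fun i j => p0 (inord i, inord j)).
- by move=> i j /bnd /lt_t; rewrite -(inj_eq val_inj) neq_ltn => ->.
- by move=> i j /bnd ij; have [] := hp0 (inord i, inord j) ij.
pose e : 'I_5 * 'I_5 := (inord i, inord j); pose f : 'I_5 * 'I_5 := (inord k, inord l).
have ef : independent e f.
  rewrite /independent /= (bnd _ _ ij) (bnd _ _ kl) /=.
  have /andP[lij j5] := ij; have /andP[lkl l5] := kl.
  have i5 := ltn_trans lij j5; have k5 := ltn_trans lkl l5.
  by move: uq; rewrite /= !inE -!(inj_eq val_inj) /= !inordK.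
have [_ be] := hp0 e (bnd _ _ ij); have [_ bf] := hp0 f (bnd _ _ kl).
have -> : 1 = b e u * b f u by rewrite be bf /ind /= ui uk; ring.
apply: Rle_trans (term_le_sum (F := fun u => b e u * b f u) u (dot_ge0 _ _ ef)) _.
have -> : \sum_j0 b e j0 * b f j0 = independence e f * dot (b e) (b f).
  by rewrite /independence ef Rmult_1_l.
apply: Rle_trans (term_le_sum (F := fun f => independence e f * dot (b e) (b f)) f _) _ => //.
apply: (term_le_sum (F := fun e => \sum_f independence e f * dot (b e) (b f)) e) => g.
by apply: sum_nonneg.
Qed.

(** A tuple is determined by its entries at [i j], at [k l] and at the fifth index [m]. The sum over
    these three choices factors, and the free entry at [m] gives the factor [INR N]. *)
Lemma tuple_sum_le (g : 'I_N -> 'I_N -> R) (i j k l : 'I_5) :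
  (forall s t, 0 <= g s t) -> uniq [:: i; j; k; l] ->
  \sum_(t : 5.-tuple 'I_N) g (tnth t i) (tnth t j) * g (tnth t k) (tnth t l) <=
  INR N * ((\sum_s \sum_t g s t) * (\sum_s \sum_t g s t)).
Proof.
move=> g0 u.
have [m cov] : exists m, forall x, x \in [:: i; j; k; l; m].
  have card4 : #|[:: i; j; k; l]| = 4%N by apply/card_uniqP.
  case: (pickP [predC [:: i; j; k; l]]) => [m hm|none]; last first.
    have : #|[:: i; j; k; l]| = #|'I_5|.
      by apply: eq_card => x; have /negbFE := none x; rewrite !inE => ->.
    by rewrite card4 card_ord.
  exists m => x.
  have um : uniq [:: m; i; j; k; l] by rewrite cons_uniq u andbT; exact: hm.
  have card5 : #|[:: m; i; j; k; l]| = #|'I_5| by rewrite card_ord; apply/card_uniqP.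
  have /(_ x) := subset_cardP card5 (subset_predT _).
  by rewrite !inE => /or4P[->|->|->|/orP[->|->]]; rewrite ?orbT.
pose h (t : 5.-tuple 'I_N) := ((tnth t i, tnth t j), (tnth t k, tnth t l), tnth t m).
have inj : injective h.
  move=> t t' [ei ej ek el em]; apply: eq_from_tnth => x.
  by have := cov x; rewrite !inE => /or4P[/eqP ->|/eqP ->|/eqP ->|/orP[]/eqP ->].
pose G (y : ('I_N * 'I_N) * ('I_N * 'I_N) * 'I_N) := g y.1.1.1 y.1.1.2 * g y.1.2.1 y.1.2.2.
have G0 y : 0 <= G y by apply: Rmult_le_pos.
apply: Rle_trans (sum_inj_le inj G0) _; apply: Req_le.
rewrite -(pair_bigA _ (fun x m => g x.1.1 x.1.2 * g x.2.1 x.2.2)) /=.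
under eq_bigr do rewrite sum_const card_ord.
rewrite -big_distrr /=; congr Rmult.
rewrite -(pair_bigA _ (fun x y => g x.1 x.2 * g y.1 y.2)) /=.
by rewrite -big_distrlr !(pair_bigA _ g).
Qed.

Lemma binomial_le_max_vertex_flow :
  INR 'C(N, 5) <= 625 * INR N * INR N * (max_vertex_flow rt * max_vertex_flow rt).
Proof.
set M := max_vertex_flow rt; have M0 : 0 <= M := max_vertex_flow_ge0.
have N0 := pos_INR N.
have flow0 s t u : 0 <= pair_flow s t u by have [] := pair_flow_bounds s t u.
have dot0 t e f : 0 <= dot (tuple_flow t e) (tuple_flow t f).
  by apply: sum_nonneg => u _; apply: Rmult_le_pos; exact: flow0.
have term0 t e f : 0 <= independence e f * dot (tuple_flow t e) (tuple_flow t f).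
  by rewrite /independence; case: ifP => _; move: (dot0 t e f); lra.
have energy0 t : 0 <= energy independence (tuple_flow t).
  by apply: sum_nonneg => e _; apply: sum_nonneg => f _; exact: term0.
have MM u : vertex_flow rt u * vertex_flow rt u <= M * M.
  by apply: Rmult_le_compat; try exact: vertex_flow_ge0; exact: vertex_flow_le_max.
have bound e f : \sum_t independence e f * dot (tuple_flow t e) (tuple_flow t f) <=
    INR N * (INR N * (M * M)).
  rewrite /independence; case: ifP => [/and3P[_ _ u4]|_]; last first.
    by rewrite big1 => [|t _]; [apply: Rmult_le_pos; nra | ring].
  under eq_bigr do rewrite Rmult_1_l.
  rewrite /dot exchange_big /=.
  apply: Rle_trans (_ : \sum_(u : 'I_N) INR N * (M * M) <= _); last first.
    by rewrite sum_const card_ord; lra.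
  apply: sum_le => u _.
  apply: Rle_trans (tuple_sum_le (g := fun s t => pair_flow s t u) _ u4) _ => //.
  by rewrite -vertex_flowE; apply: Rmult_le_compat_l.
have -> : INR 'C(N, 5) = \sum_(t in [set t : 5.-tuple 'I_N | sorted ltn (map val t)]) 1.
  by rewrite sum_const card_ltn_sorted_tuples Rmult_1_r.
(* Passing from increasing tuples to all tuples adds nonnegative terms only, and makes the sums
   factor as in [tuple_sum_le]. *)
apply: Rle_trans (_ : \sum_t energy independence (tuple_flow t) <= _).
  apply: Rle_trans (sum_le_cond _ (fun t => t \in [set t : 5.-tuple 'I_N |
    sorted ltn (map val t)]) energy0).
  by apply: sum_le => t; rewrite inE => /energy_ge1.
rewrite exchange_big /=.
apply: Rle_trans (_ : \sum_(e : 'I_5 * 'I_5) \sum_(f : 'I_5 * 'I_5) INR N * (INR N * (M * M)) <= _).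
  by apply: sum_le => e _; rewrite exchange_big /=; apply: sum_le.
(* The constant is [625 = 25 * 25], one for each pair of elements of ['I_5 * 'I_5]. *)
rewrite !sum_const card_prod card_ord /=; lra.
Qed.

Lemma max_vertex_flow_lower : (2 <= N)%N ->
  / 1400 * INR N * sqrt (INR N) <= max_vertex_flow rt.
Proof.
move=> N2; have M1 := max_vertex_flow_ge1 N2; set M := max_vertex_flow rt in M1 *.
have N0 := pos_INR N; have S0 := sqrt_pos (INR N); have SS := sqrt_sqrt _ N0.
case: (leqP 5 N) => N5; last first.
  have N4 : INR N <= 4 by rewrite (_ : 4 = INR 4); [apply: le_INR; apply/leP | rewrite /=; lra].
  have : sqrt (INR N) <= 2 by rewrite -(sqrt_square 2); [apply: sqrt_le_1_alt; lra | lra].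
  by nra.
(* The constant [3125 = 5 ^ 5] gives equality at [N = 5]. In terms of [x = N - 5] the difference of
   the two sides is a polynomial with nonnegative coefficients. *)
have bin : INR N ^ 5 <= 3125 * INR 'C(N, 5).
  have -> : INR 'C(N, 5) = INR (N ^_ 5) / 120.
    by rewrite -bin_ffact mult_INR (_ : INR 5`! = 120) /=; [field | rewrite /=; lra].
  case: N N5 => [|[|[|[|[|n]]]]] // _; rewrite !ffactSS ffactn0 muln1 !mult_INR !S_INR.
  have := pos_INR n; set x := INR n => x0.
  have x2 : 0 <= x * x by nra.
  have x3 : 0 <= x * x * x by nra.
  have x4 : 0 <= x * x * x * x by nra.
  have x5 : 0 <= x * x * x * x * x by nra.
  by nra.
have := binomial_le_max_vertex_flow; rewrite -/M => up.
(* Here [1953125 = 3125 * 625], whose square root is just below 1400; this fixes the final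
   constant. *)
have N3 : INR N * INR N * INR N <= 1953125 * (M * M).
  have n0 : 0 < INR N by apply: (lt_INR 0); apply/ltP; exact: ltnW.
  apply: (Rmult_le_reg_l (INR N * INR N)); nra.
apply: Rsqr_incr_0_var; last lra.
rewrite /Rsqr; nra.
Qed.

End Flow.

Theorem theorem2 :
  exists c : R, (0 < c) /\
  forall (N : nat) (adj : rel 'I_N) (rt : 'I_N -> 'I_N -> seq (seq 'I_N * R)),
    (2 <= N)%N ->
    simple_graph adj -> connected_graph adj -> planar adj ->
    routing adj rt ->
    (c * INR N * sqrt (INR N) <= max_vertex_flow rt) /\
    (max_vertex_flow rt <= INR N * (INR N - 1) / 2).
Proof.
exists (/ 1400); split; first lra.
move=> N adj rt N2 graph _ plane rtP; split; last exact: (max_vertex_flow_upper rtP).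
exact: (max_vertex_flow_lower rtP).
Qed.
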